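(* Let $N\ge1$, $\lambda_1,\dots,\lambda_N>0$ and $0<B<N$. Let $T>0$ be the LRU characteristic time, i.e. the unique solution of $\sum_{i=1}^N\bigl(1-e^{-\lambda_iT}\bigr)=B$. For $h\in(0,1)$ define \[ U_i(h)=\lambda_i\,\mathrm{li}(1-h),\qquad i=1,\dots,N, \] where $\mathrm{li}(x)=\int_0^x\frac{dt}{\ln t}$ for $0<x<1$. Then $U_i'(h)=\frac{-\lambda_i}{\log(1-h)}$, and for every $\alpha>0$, $(U_i')^{-1}(\alpha)=1-e^{-\lambda_i/\alpha}$. Moreover, the optimal solution of \[ \text{maximize } \sum_{i=1}^N U_i(h_i)\quad\text{such that}\quad \sum_{i=1}^N h_i=B,\quad 0<h_i<1,\ i=1,\dots,N, \] is given by the LRU hit probabilities $h_i=1-e^{-\lambda_iT}$, $i=1,\dots,N$, and the Lagrange multiplier $\alpha$ of the constraint $\sum_i h_i=B$ (the number with $U_i'(h_i)=\alpha$ for all $i$ at the optimum) satisfies $T=1/\alpha$.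
   Context: Requests for file $i$ arrive at a cache of size $B$ as a Poisson process of rate $\lambda_i$. The LRU policy is identified with its characteristic-time description: the hit probability of file $i$ is $h_i=1-e^{-\lambda_iT}$, where the characteristic time $T$ is determined by $\sum_i h_i=B$. Logarithms are natural. The Lagrangian of the maximization problem is $\mathcal{L}(\mathbf{h},\alpha)=\sum_{i}U_i(h_i)-\alpha\bigl[\sum_i h_i-B\bigr]$. *)

(* Defs.v *)
From HB Require Import structures.
From mathcomp Require Export all_boot all_order all_algebra.
From mathcomp Require Export all_classical all_reals all_analysis.
Set Implicit Arguments.
Unset Strict Implicit.
Unset Printing Implicit Defensive.
Export Order.TTheory GRing.Theory Num.Theory.
Export numFieldNormedType.Exports.
Local Open Scope classical_set_scope.
Local Open Scope ring_scope.

(* Only meaningful for 0 < x < 1; there the integrand extends continuously by 0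
   at t = 0, so this is an ordinary convergent integral. *)
Definition li (R : realType) (x : R) : R :=
  \int[lebesgue_measure]_(t in `]0, x[) (ln t)^-1.

(* The utility of a file with request rate [l], as a function of its hit
   probability; only its values on ]0, 1[ matter. *)
Definition utility (R : realType) (l h : R) : R := l * li (1 - h).

Definition lru_hit (R : realType) (N : nat) (lam : 'I_N -> R) (T : R) : 'rV[R]_N :=
  \row_i (1 - expR (- lam i * T)).

Definition is_characteristic_time (R : realType) (N : nat)
    (lam : 'I_N -> R) (B T : R) : Prop :=
  0 < T /\ \sum_(i < N) lru_hit lam T ord0 i = B.

Definition objective (R : realType) (N : nat) (lam : 'I_N -> R) (h : 'rV[R]_N) : R :=
  \sum_(i < N) utility (lam i) (h ord0 i).

Definition feasible (R : realType) (N : nat) (B : R) (h : 'rV[R]_N) : Prop :=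
  \sum_(i < N) h ord0 i = B /\ forall i, 0 < h ord0 i < 1.

Definition is_optimal (R : realType) (N : nat) (lam : 'I_N -> R) (B : R)
    (h : 'rV[R]_N) : Prop :=
  feasible B h /\ forall h', feasible B h' -> objective lam h' <= objective lam h.

Definition lagrangian (R : realType) (N : nat) (lam : 'I_N -> R) (B : R)
    (h : 'rV[R]_N) (alpha : R) : R :=
  objective lam h - alpha * (\sum_(i < N) h ord0 i - B).

(* Every partial derivative of the Lagrangian in the hit probabilities exists
   and vanishes at [h]; [delta_mx ord0 i] is the i-th standard basis vector. *)
Definition is_lagrange_multiplier (R : realType) (N : nat) (lam : 'I_N -> R)
    (B : R) (h : 'rV[R]_N) (alpha : R) : Prop :=
  forall i : 'I_N,
    is_derive h (delta_mx ord0 i) (fun v => lagrangian lam B v alpha) 0.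

(* [f] restricts to a bijection from [A] onto [B] with inverse [g]. *)
Definition inverse_on (S S' : Type) (A : set S) (B : set S')
    (f : S -> S') (g : S' -> S) : Prop :=
  [/\ set_fun A B f, set_fun B A g, {in A, cancel f g} & {in B, cancel g f}].

(* Main.v *)
(* By the fundamental theorem of calculus li' = 1/ln on ]0, 1[, so U_i has the
   strictly decreasing derivative - lam_i / ln (1 - h). At the LRU point
   ln (1 - h_i) = - lam_i T, hence every U_i has the same slope 1/T there; strict
   concavity then makes this point the unique maximizer on the hyperplane
   sum h_i = B, with multiplier 1/T. *)
Require Import Defs.
From mathcomp Require Import ring lra.
Local Open Scope classical_set_scope.
Local Open Scope ring_scope.

(** * Calculus of [li]: its derivative, and the slope and strict concavity of the utilities *)

Section LogarithmicIntegral.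
Context {R : realType}.
Implicit Types x y u l h k : R.
Let mu := @lebesgue_measure R.

Lemma continuous_inv_ln x : 0 < x < 1 ->
  {for x, continuous (fun t : R => (ln t)^-1)}.
Proof.
move=> /andP[x0 x1]; apply: cvgV.
  by rewrite lt_eqF// ln_lt0// x0.
exact: continuous_ln.
Qed.

(** The integrand is bounded: for [0 < t <= u < 1], [ln t <= ln u < 0], so
    [|1 / ln t| <= |1 / ln u|]. Continuity on the open unit interval gives measurability. *)
Lemma integrable_inv_ln u : u < 1 ->
  mu.-integrable `]0, u] (EFin \o (fun t : R => (ln t)^-1)).
Proof.
move=> u1; apply: measurable_bounded_integrable.
- exact: measurable_itv.
- rewrite /= lebesgue_measure_itv; case: ifP => _; exact: ltry.
- have mf : measurable_fun (`]0, 1[ : set R) (fun t : R => (ln t)^-1).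
    apply: measurable_realfun.open_continuous_measurable_fun; first exact: interval_open.
    by move=> t; rewrite inE/= in_itv/= => t01; exact: continuous_inv_ln.
  apply: measurable_funS mf; first exact: measurable_itv.
  by apply: subset_itvl; rewrite bnd_simp.
- exists `|(ln u)^-1|; split; first exact: num_real.
  move=> M uM t /=; rewrite in_itv/= => /andP[t0 tu].
  have u0 : 0 < u by exact: lt_le_trans tu.
  have lnu : ln u < 0 by rewrite ln_lt0// u0.
  have lntu : ln t <= ln u by rewrite ler_ln.
  rewrite (le_trans _ (ltW uM))// !normfV lef_pV2 ?posrE ?normr_gt0 ?lt_eqF//.
    by rewrite !ltr0_norm ?lerN2// (le_lt_trans lntu).
  exact: le_lt_trans lnu.
Qed.

(** The fundamental theorem of calculus is applied to [F], the integral including its upper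
    endpoint. Since a point has measure zero, [F] and [li] agree near [x]. *)
Lemma is_derive_li x : 0 < x < 1 -> is_derive x 1 (@li R) (ln x)^-1.
Proof.
move=> /andP[x0 x1].
pose F y := \int[mu]_(t in `]0%R, y]) (ln t)^-1.
(* The midpoint of [x] and 1 serves as right end of an interval that has [x] in its interior and
   stays away from the singularity of the integrand at 1. *)
have [xu u1] : x < (x + 1) / 2 /\ (x + 1) / 2 < 1 by split; lra.
have [dF F'] : derivable F x 1 /\ F^`()%classic x = (ln x)^-1.
  apply: (continuous_FTC1 xu (integrable_inv_ln _ u1)) => //.
  by apply: continuous_inv_ln; rewrite x0.
have isdF : is_derive x 1 F (ln x)^-1 :=
  DeriveDef dF (etrans (esym (derive1E F x)) F').
apply: near_eq_is_derive isdF.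
near=> y; rewrite /F /li Rintegral_itv_bndo_bndc//.
apply: (integrableS _ _ _ (integrable_inv_ln y _)) => //.
- by apply: subset_itvl; rewrite bnd_simp.
- by near: y; exact: lt_nbhsl.
Unshelve. all: by end_near. Qed.

Lemma is_derive_utility l h : 0 < h < 1 ->
  is_derive h 1 (utility l) (- l / ln (1 - h)).
Proof.
move=> /andP[h0 h1].
have dli : is_derive (1 - h) 1 (@li R) (ln (1 - h))^-1.
  by apply: is_derive_li; apply/andP; split; lra.
have dsub : is_derive h 1 (fun y : R => 1 - y) (0 - 1).
  exact: is_deriveB.
have dcomp := @is_derive1_comp R (@li R) (fun y => 1 - y) h _ _ dli dsub.
apply: is_derive_eq (is_deriveZ l dcomp) _.
by rewrite /GRing.scale/=; ring.
Qed.

Lemma derive1_utility l h : 0 < h < 1 ->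
  (derive1 (utility l)) h = - l / ln (1 - h).
Proof. by move=> /(is_derive_utility l _) du; rewrite derive1E derive_val. Qed.

(* Strict concavity of [utility l] in tangent-line form. *)
Lemma utility_lt_tangent l h k : 0 < l -> 0 < h < 1 -> 0 < k < 1 -> k != h ->
  utility l k < utility l h + - l / ln (1 - h) * (k - h).
Proof.
move=> l0 /andP[h0 h1] /andP[k0 k1] kh.
have du x : 0 < x < 1 -> is_derive x 1 (utility l) (- l / ln (1 - x)).
  exact: is_derive_utility.
have cu a b : 0 < a -> b < 1 -> {within `[a, b], continuous (utility l)}.
  move=> a0 b1; apply: derivable_within_continuous => x.
  rewrite in_itv/= => /andP[ax xb]; apply: (@ex_derive _ _ _ _ _ _ _ (du x _)).
  by rewrite (lt_le_trans a0 ax) (le_lt_trans xb b1).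
have slope x y : 0 < x -> x < y -> y < 1 ->
    - l / ln (1 - y) < - l / ln (1 - x).
  move=> x0 xy y1; rewrite !mulNr ltrN2 ltr_pM2l//.
  have lnx : ln (1 - x) < 0 by rewrite ln_lt0//; apply/andP; split; lra.
  have lny : ln (1 - y) < 0 by rewrite ln_lt0//; apply/andP; split; lra.
  by rewrite ltf_nV2 ?negrE// ltr_ln ?posrE; lra.
(* By the mean value theorem the chord between [k] and [h] has the slope of the utility at some [c]
   strictly between them. By [slope] it is steeper than the tangent at [h] when [k < h] and flatter
   when [h < k]; either way the utility at [k] falls below the tangent. *)
rewrite -ltrBlDl; case: (ltgtP k h) kh => // [kh|hk] _.
- have [c /[!in_itv]/= /andP[kc ch] E] : exists2 c, c \in `]k, h[ &
      utility l h - utility l k = - l / ln (1 - c) * (h - k).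
    apply: (MVT kh) => [x /[!in_itv]/= /andP[kx xh]|]; last exact: cu.
    by apply: du; apply/andP; split; lra.
  rewrite -[k - h]opprB mulrN ltrNr opprB E ltr_pM2r ?subr_gt0//.
  by apply: slope; lra.
- have [c /[!in_itv]/= /andP[hc ck] E] : exists2 c, c \in `]h, k[ &
      utility l k - utility l h = - l / ln (1 - c) * (k - h).
    apply: (MVT hk) => [x /[!in_itv]/= /andP[hx xk]|]; last exact: cu.
    by apply: du; apply/andP; split; lra.
  rewrite E ltr_pM2r ?subr_gt0//.
  by apply: slope; lra.
Qed.

End LogarithmicIntegral.

(** * Existence and uniqueness of the characteristic time, and optimality of the LRU point *)

Section CharacteristicTime.
Context {R : realType} (N : nat) (lam : 'I_N -> R) (B : R).
Hypothesis lam_gt0 : forall i, 0 < lam i.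

Lemma lru_hit_itv T i : 0 < T -> 0 < lru_hit lam T ord0 i < 1.
Proof.
move=> T0; rewrite mxE subr_gt0 gtrBl expR_gt0 andbT -[ltRHS]expR0 ltr_expR.
by rewrite mulNr oppr_lt0 mulr_gt0.
Qed.

Lemma ln_lru_miss T i : ln (1 - lru_hit lam T ord0 i) = - lam i * T.
Proof. by rewrite mxE subKr expRK. Qed.

Lemma marginal_utility_lru T i : 0 < T ->
  - lam i / ln (1 - lru_hit lam T ord0 i) = T^-1.
Proof.
move=> T0; rewrite ln_lru_miss; have := lam_gt0 i => l0.
by field; rewrite !gt_eqF.
Qed.

Lemma total_hit_lt (S T : R) : (0 < N)%N -> S < T ->
  \sum_(i < N) lru_hit lam S ord0 i < \sum_(i < N) lru_hit lam T ord0 i.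
Proof.
move=> N0 ST; apply: ltr_sum => [|i _].
  by apply/hasP; exists (Ordinal N0); rewrite ?mem_index_enum.
by rewrite !mxE ltrD2l ltrN2 ltr_expR !mulNr ltrN2 ltr_pM2l.
Qed.

Lemma characteristic_time_unique (S T : R) : (0 < N)%N ->
  is_characteristic_time lam B S -> is_characteristic_time lam B T -> S = T.
Proof.
move=> N0 [_ SB] [_ TB].
by have [/(total_hit_lt _ _ N0)|/(total_hit_lt _ _ N0)|//] := ltgtP S T;
  rewrite SB TB ltxx.
Qed.

Lemma continuous_total_hit :
  continuous (fun T : R => \sum_(i < N) lru_hit lam T ord0 i).
Proof.
apply: continuous_big => [|i _]; first exact: add_continuous.
move=> T; rewrite /continuous_at mxE; under eq_fun do rewrite mxE.
apply: cvgB; first exact: cvg_cst.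
apply: (@continuous_comp _ _ _ (fun t : R => - lam i * t)).
  by apply: cvgM; [exact: cvg_cst|exact: cvg_id].
exact: continuous_expR.
Qed.

(** Intermediate value theorem for the total hit probability, which is 0 at time 0 and must be shown
    to reach [B] at some explicit later time. *)
Lemma characteristic_time_exists : 0 < B < N%:R ->
  exists T, is_characteristic_time lam B T.
Proof.
move=> /andP[B0 BN].
have N0 : 0 < N%:R :> R by exact: lt_trans BN.
pose q := (N%:R - B) / N%:R.
have q0 : 0 < q by rewrite divr_gt0 ?subr_gt0.
have q1 : q < 1 by rewrite ltr_pdivrMr// mul1r gtrBl.
have lnq : 0 < - ln q by rewrite oppr_gt0 ln_lt0// q0.
(* Past this time every miss probability is at most [q = (N - B) / N]. *)
pose T := \sum_(j < N) - ln q / lam j.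
(* The sum [T] replaces a maximum: its terms are nonnegative, so it dominates each of them. *)
have T_ge i : - ln q <= lam i * T.
  rewrite mulrC -ler_pdivrMr// /T (bigD1 i)//= lerDl sumr_ge0// => j _.
  by rewrite divr_ge0// ltW.
have T0 : 0 <= T by rewrite sumr_ge0// => j _; rewrite divr_ge0// ltW.
pose g (t : R) := \sum_(i < N) lru_hit lam t ord0 i.
have g0 : g 0 = 0 by apply: big1 => i _; rewrite mxE mulr0 expR0 subrr.
have gT : B <= g T.
  have -> : B = \sum_(i < N) (1 - q).
    by rewrite sumr_const card_ord -mulr_natr /q; field; rewrite gt_eqF.
  apply: ler_sum => i _; rewrite mxE lerD2l lerN2 -[leRHS]lnK ?posrE//.
  by rewrite ler_expR mulNr lerNl.
have [||t /[!in_itv]/= /andP[t0 _] gt] := @IVT R g 0 T B T0.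
- by apply: continuous_subspaceT; exact: continuous_total_hit.
- by rewrite g0 ge_min le_max (ltW B0) gT orbT.
(* The intermediate value theorem only yields [0 <= t]; the value 0 is excluded because it would
   force [B = 0]. *)
exists t; split => //; rewrite lt_neqAle t0 andbT.
by apply: contraTneq B0 => t_eq0; rewrite -gt -t_eq0 g0 ltxx.
Qed.

Lemma feasible_lru T : is_characteristic_time lam B T ->
  feasible B (lru_hit lam T).
Proof. by move=> [T0 TB]; split => // i; exact: lru_hit_itv. Qed.

(* The tangents at the LRU point all have slope [1/T], and the constraint makes
   their linear parts cancel in the sum. *)
Lemma objective_lt_lru T (h : 'rV[R]_N) : is_characteristic_time lam B T ->
  feasible B h -> h != lru_hit lam T ->
  objective lam h < objective lam (lru_hit lam T).
Proof.
move=> [T0 TB] [hB h01]; set k := lru_hit lam T.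
rewrite -subr_eq0 => /rV0Pn[i]; rewrite 2!mxE -/k subr_eq0 => hki.
pose tangent j := utility (lam j) (k ord0 j) + T^-1 * (h ord0 j - k ord0 j).
have lt_tangent j : h ord0 j != k ord0 j ->
    utility (lam j) (h ord0 j) < tangent j.
  move=> hkj; rewrite /tangent -(marginal_utility_lru _ j T0).
  by apply: utility_lt_tangent => //; exact: lru_hit_itv.
have le_tangent j : utility (lam j) (h ord0 j) <= tangent j.
  have [hkj|/lt_tangent/ltW//] := eqVneq (h ord0 j) (k ord0 j).
  by rewrite /tangent hkj subrr mulr0 addr0.
have -> : objective lam k = \sum_(j < N) tangent j.
  by rewrite big_split/= -mulr_sumr sumrB hB TB subrr mulr0 addr0.
(* The coordinate [i], where [h] differs from the LRU point, is split off to supply the strict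
   inequality. *)
rewrite /objective (bigD1 i)//= [ltRHS](bigD1 i)//=.
by rewrite ltr_leD ?lt_tangent// ler_sum.
Qed.

Lemma is_optimal_lruP T (h : 'rV[R]_N) : is_characteristic_time lam B T ->
  is_optimal lam B h <-> h = lru_hit lam T.
Proof.
move=> TB; split=> [[hB hmax]|->].
  apply/eqP; apply: contraT => /(objective_lt_lru _ _ TB hB).
  by rewrite ltNge hmax//; exact: feasible_lru.
split=> [|h' h'B]; first exact: feasible_lru.
have [->//|] := eqVneq h' (lru_hit lam T).
by move/(objective_lt_lru _ _ TB h'B)/ltW.
Qed.

End CharacteristicTime.

(** * Partial derivatives of the Lagrangian *)

Section Lagrangian.
Context {R : realType} {N : nat}.
Implicit Types (h : 'rV[R]_N) (lam : 'I_N -> R).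

(** Moving along the [j]-th basis vector changes only coordinate [j]. The difference quotient is
    therefore the one-variable quotient of [f] if [i = j], and identically 0 otherwise. *)
Lemma is_derive_coord (f : R -> R) (df : R) h (i j : 'I_N) :
  is_derive (h ord0 i) 1 f df ->
  is_derive h (delta_mx ord0 j) (fun v : 'rV[R]_N => f (v ord0 i))
    (if i == j then df else 0).
Proof.
move=> [ddf vdf].
have shiftE t : (t *: delta_mx ord0 j + h) ord0 i =
    (if i == j then t else 0) + h ord0 i.
  by rewrite !mxE eqxx/=; case: eqP => _; rewrite ?mulr1 ?mulr0.
have [ij|ij] := eqVneq i j.
  have E : (fun t : R => t^-1 *: (((fun v : 'rV[R]_N => f (v ord0 i)) \o shift h)
      (t *: delta_mx ord0 j) - f (h ord0 i))) =
      (fun t => t^-1 *: ((f \o shift (h ord0 i)) (t *: 1) - f (h ord0 i))).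
    by apply/funext => t /=; rewrite shiftE ij eqxx /GRing.scale/= mulr1.
  by split; [rewrite /derivable E|rewrite /derive E].
have E : (fun t : R => t^-1 *: (((fun v : 'rV[R]_N => f (v ord0 i)) \o shift h)
    (t *: delta_mx ord0 j) - f (h ord0 i))) = cst 0.
  by apply/funext => t /=; rewrite shiftE (negbTE ij) add0r subrr scaler0.
split; first by rewrite /derivable E; exact: is_cvg_cst.
by rewrite /derive E; exact: lim_cst.
Qed.

(** The Lagrangian is separable: it is a sum of one-variable functions [term j] of the coordinates
    plus the constant [alpha * B], so only the [i]-th summand contributes. *)
Lemma is_derive_lagrangian lam (B alpha : R) h (i : 'I_N) :
  (forall j, 0 < h ord0 j < 1) ->
  is_derive h (delta_mx ord0 i) (fun v => lagrangian lam B v alpha)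
    (- lam i / ln (1 - h ord0 i) - alpha).
Proof.
move=> h01.
pose term (j : 'I_N) x := utility (lam j) x - alpha * x.
have dterm j : is_derive (h ord0 j) 1 (term j)
    (- lam j / ln (1 - h ord0 j) - alpha).
  have du := is_derive_utility (lam j) _ (h01 j).
  have dl : is_derive (h ord0 j) 1 (alpha \*: (@id R)) (alpha *: 1).
    exact: is_deriveZ.
  apply: is_derive_eq (is_deriveB du dl) _.
  by rewrite /GRing.scale/= mulr1.
have dsum := is_derive_sum (fun j => is_derive_coord _ _ _ _ i (dterm j)).
have dB := is_deriveD dsum (is_derive_cst (alpha * B) h (delta_mx ord0 i)).
have -> : (fun v => lagrangian lam B v alpha) =
    \sum_(j < N) (fun v : 'rV[R]_N => term j (v ord0 j)) + cst (alpha * B).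
  apply/funext => v; transitivity (\sum_(j < N) term j (v ord0 j) + alpha * B).
    by rewrite /term sumrB -mulr_sumr /lagrangian /objective; ring.
  by rewrite fctE fct_sumE.
apply: is_derive_eq dB _.
by rewrite addr0 -big_mkcond big_pred1_eq.
Qed.

End Lagrangian.

Theorem mainTheorem3 (R : realType) (N : nat) (lam : 'I_N -> R) (B : R)
    (hN : (1 <= N)%N) (hlam : forall i, 0 < lam i) (hB : 0 < B < N%:R) :
  [/\ exists! T : R, is_characteristic_time lam B T,
      forall (i : 'I_N) (h : R), 0 < h < 1 ->
        is_derive h 1 (utility (lam i)) (- lam i / ln (1 - h)),
      forall i : 'I_N,
        inverse_on `]0, 1[ `]0, +oo[ (derive1 (utility (lam i)))
          (fun alpha : R => 1 - expR (- lam i / alpha)) &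
      forall T : R, is_characteristic_time lam B T ->
        (forall h : 'rV[R]_N, is_optimal lam B h <-> h = lru_hit lam T) /\
        (exists alpha : R,
           [/\ unique (is_lagrange_multiplier lam B (lru_hit lam T)) alpha,
               forall i : 'I_N,
                 (derive1 (utility (lam i))) (lru_hit lam T ord0 i) = alpha &
               T = 1 / alpha])].
Proof.
split.
- have [T TB] := characteristic_time_exists _ _ _ hlam hB.
  exists T; split=> // S SB.
  exact: (characteristic_time_unique _ _ _ hlam _ _ hN TB SB).
- by move=> i h; exact: is_derive_utility.
- move=> i; have l0 := hlam i.
  have ln_lt (h : R) : 0 < h < 1 -> ln (1 - h) < 0.
    by move=> /andP[h0 h1]; rewrite ln_lt0//; apply/andP; split; lra.
  have hit_itv (alpha : R) : 0 < alpha -> 0 < 1 - expR (- lam i / alpha) < 1.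
    move=> a0; rewrite subr_gt0 gtrBl expR_gt0 andbT -[ltRHS]expR0 ltr_expR.
    by rewrite mulNr oppr_lt0 divr_gt0.
  (* The derivative is positive because [ln (1 - h) < 0]; the two cancellations reduce to [expR] and
     [ln] being mutually inverse. *)
  split=> [h|alpha|h|alpha]; rewrite ?inE/= ?in_itv/= ?andbT.
  + move=> h01; rewrite derive1_utility// mulNr -mulrN -invrN.
    by rewrite divr_gt0// oppr_gt0 ln_lt.
  + exact: hit_itv.
  + move=> h01; rewrite derive1_utility//.
    have -> : - lam i / (- lam i / ln (1 - h)) = ln (1 - h).
      by have := ln_lt h h01 => lnh; field; rewrite lt_eqF//= gt_eqF.
    by rewrite lnK ?posrE ?subKr//; case/andP: h01; lra.
  + move=> a0; rewrite derive1_utility ?hit_itv// subKr expRK.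
    by field; rewrite !gt_eqF.
- move=> T TB; split=> [h|]; first exact: is_optimal_lruP.
  have T0 : 0 < T by case: TB.
  have hit01 i : 0 < lru_hit lam T ord0 i < 1 by exact: lru_hit_itv.
  (* At the LRU point all partial derivatives take the same value, which vanishes exactly for
     [alpha = T^-1]. *)
  have dL alpha i : is_derive (lru_hit lam T) (delta_mx ord0 i)
      (fun v => lagrangian lam B v alpha) (T^-1 - alpha).
    by rewrite -(marginal_utility_lru _ _ hlam _ i T0); exact: is_derive_lagrangian.
  exists T^-1; split; last by rewrite div1r invrK.
  (* For uniqueness one coordinate suffices; [1 <= N] provides the index 0. *)
  + split=> [i|alpha /(_ (Ordinal hN))[_]].
      by apply: is_derive_eq (dL _ i) _; rewrite subrr.
    by have [_ ->] := dL alpha (Ordinal hN); move/eqP; rewrite subr_eq0 => /eqP.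
  + by move=> i; rewrite derive1_utility// marginal_utility_lru.
Qed.
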